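(* Assume $r>1$, and define the map $F:\mathbb{R}\to\mathbb{R}$ by $$F(y)=-1+\exp\left[\frac{ry+1-e^{ry}}{y}\right]\quad (y\neq 0),\qquad F(0)=0.$$ Let $y(t)$ be a solution of Wright's equation $$y'(t)=-r\,y(t-1)\,(1+y(t))$$ with $y(0)>-1$. Then: (a) If $r\le 3/2$, then $\lim_{t\to\infty}y(t)=0$. (b) If $r>3/2$, then $$\alpha_1\le\liminf_{t\to\infty}y(t)\le\limsup_{t\to\infty}y(t)\le\beta_1,$$ where $\{\alpha_1,\beta_1\}$, $\alpha_1<\beta_1$, is the unique $2$-cycle of $F$.
   Context: A solution of Wright's equation is a continuous function $y:[-1,\infty)\to\mathbb{R}$, determined by a continuous initial function $\phi$ on $[-1,0]$ (so $y=\phi$ on $[-1,0]$), which is differentiable and satisfies the equation for all $t>0$. The condition $y(0)>-1$ means $\phi(0)>-1$. A $2$-cycle of $F$ is a set $\{\alpha_1,\beta_1\}$ with $\alpha_1\ne\beta_1$, $F(\alpha_1)=\beta_1$ and $F(\beta_1)=\alpha_1$. *)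

(* Defs.v *)
From HB Require Import structures.
From mathcomp Require Import all_boot all_order all_algebra.
From mathcomp Require Import all_classical all_reals all_analysis.

Set Implicit Arguments.
Unset Strict Implicit.
Unset Printing Implicit Defensive.

Import Order.TTheory GRing.Theory Num.Theory.
Import numFieldNormedType.Exports.

Local Open Scope classical_set_scope.
Local Open Scope ring_scope.

(* The solution is carried by a total function whose values on ]-oo, -1[ are
   irrelevant; the continuous initial function is its restriction to [-1, 0]. *)
Definition wright_solution (R : realType) (r : R) (y : R -> R) : Prop :=
  {within `[-1, +oo[, continuous y} /\
  forall t : R, 0 < t -> is_derive t 1 y (- r * y (t - 1) * (1 + y t)).

Definition F (R : realType) (r : R) (y : R) : R :=
  if y == 0 then 0 else -1 + expR ((r * y + 1 - expR (r * y)) / y).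

Definition two_cycle (R : realType) (f : R -> R) (C : set R) : Prop :=
  exists a b : R, [/\ a != b, f a = b, f b = a & C = [set a; b]].

Definition liminf_pinfty (R : realType) (y : R -> R) : \bar R :=
  limf_einf (fun t => (y t)%:E) (pinfty_nbhs R).

Definition limsup_pinfty (R : realType) (y : R -> R) : \bar R :=
  limf_esup (fun t => (y t)%:E) (pinfty_nbhs R).

(* Main.v *)
Require Import Defs.
From mathcomp Require Import all_boot all_order all_algebra.
From mathcomp Require Import all_classical all_reals all_analysis.
From mathcomp Require Import ring lra.

Set Implicit Arguments.
Unset Strict Implicit.
Unset Printing Implicit Defensive.

Import Order.TTheory GRing.Theory Num.Theory.
Import numFieldNormedType.Exports.

Local Open Scope classical_set_scope.
Local Open Scope ring_scope.

(* Put x = ln (1 + y), so that x'(t) = - r (e^x(t-1) - 1), and let U = limsup x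
   and W = - liminf x. Unless x tends to 0 it changes sign infinitely often. If
   y >= -a eventually, then after a zero xi of x one has x(v) >= - r a (xi - v)
   on [xi - 1, xi], and integrating the equation over [xi, xi + 1] bounds x from
   above, with e^x(v) - 1 at v = t - 1 bounded below by either -a or
   e^(- r a (xi - v)) - 1; bounds from below arise in the same way.

   (b) The exponential bound alone gives U <= P(W) and W <= Q(U), where the
   2-cycles of F are the pairs u = P(w), w = Q(u) with u, w > 0. For r >= 3/2 the
   elasticities of P at w = Q(u) and of Q at u have a product less than 1, so that
   P(Q(u))/u decreases: the 2-cycle is unique, and U <= P(Q(U)) puts U below it.

   (a) For r <= 3/2 the better of the two bounds gives U <= W / (1 + 2W/3) and
   W < U / (1 - 2U/3) if U > 0, which together force U = W = 0. *)

(** * Inequalities between exponentials and polynomials *)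

Lemma is_derive_continuous (R : realType) (f : R -> R) (x df : R) :
  is_derive x 1 f df -> {for x, continuous f}.
Proof. by move=> [+ _] => /derivable1_diffP/differentiable_continuous. Qed.

Lemma is_derive_within (R : realType) (f df : R -> R) (a b : R) :
  (forall t, a <= t <= b -> is_derive t 1 f (df t)) ->
  {within `[a, b], continuous f}.
Proof.
move=> dfE; apply: derivable_within_continuous => t; rewrite in_itv/= => tab.
by have [] := dfE _ tab.
Qed.

Lemma le_of_derive_le0 (R : realType) (f df : R -> R) (a b : R) : a <= b ->
  (forall t, a <= t <= b -> is_derive t 1 f (df t)) ->
  (forall t, a < t < b -> df t <= 0) -> f b <= f a.
Proof.
move=> ab dfE df0; move: ab; rewrite le_eqVlt => /predU1P[-> //|ab].
have dfE' t : t \in `]a, b[ -> is_derive t 1 f (df t).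
  by rewrite in_itv/= => /andP[at_ tb]; apply: dfE; rewrite !ltW.
have [c cab E] := MVT ab dfE' (is_derive_within dfE).
have dfc : df c <= 0 by apply: df0; move: cab; rewrite in_itv.
by rewrite -subr_le0 E mulr_le0_ge0// subr_ge0 ltW.
Qed.

Lemma le_of_derive_ge0 (R : realType) (f df : R -> R) (a b : R) : a <= b ->
  (forall t, a <= t <= b -> is_derive t 1 f (df t)) ->
  (forall t, a < t < b -> 0 <= df t) -> f a <= f b.
Proof.
move=> ab dfE df0; rewrite -lerN2.
apply: (@le_of_derive_le0 _ (fun t => - f t) (fun t => - df t)) => // t tab.
  by apply: is_deriveN; exact: dfE.
by rewrite oppr_le0 df0.
Qed.

Lemma lt_of_derive_lt0 (R : realType) (f df : R -> R) (a b : R) : a < b ->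
  (forall t, a <= t <= b -> is_derive t 1 f (df t)) ->
  (forall t, a < t < b -> df t < 0) -> f b < f a.
Proof.
move=> ab dfE df0.
have dfE' t : t \in `]a, b[ -> is_derive t 1 f (df t).
  by rewrite in_itv/= => /andP[at_ tb]; apply: dfE; rewrite !ltW.
have [c cab E] := MVT ab dfE' (is_derive_within dfE).
have dfc : df c < 0 by apply: df0; move: cab; rewrite in_itv.
by rewrite -subr_lt0 E nmulr_rlt0// subr_gt0.
Qed.

Lemma lt_of_derive_gt0 (R : realType) (f df : R -> R) (a b : R) : a < b ->
  (forall t, a <= t <= b -> is_derive t 1 f (df t)) ->
  (forall t, a < t < b -> 0 < df t) -> f a < f b.
Proof.
move=> ab dfE df0; rewrite -ltrN2.
apply: (@lt_of_derive_lt0 _ (fun t => - f t) (fun t => - df t)) => // t tab.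
  by apply: is_deriveN; exact: dfE.
by rewrite oppr_lt0 df0.
Qed.

(** Bounds on the limits [U] and [W] come only from levels strictly above them; this carries such a
    bound to the limit itself. *)
Lemma le_of_le_right (R : realType) (f : R -> R) (c x : R) :
  {for x, continuous f} -> (forall z, x < z -> c <= f z) -> c <= f x.
Proof.
move=> cf H; rewrite leNgt; apply/negP => fxc.
have [e /= e0 He] := cvgr_lt _ cf _ fxc.
have xe : x < x + e / 2 by rewrite ltrDl divr_gt0.
have := H _ xe; rewrite leNgt He//= opprD addNKr normrN gtr0_norm ?divr_gt0//.
by rewrite gtr_pMr// invf_lt1// ltr1n.
Qed.

(** A class closed under differentiation, with the coefficients as arguments so that derivatives are
    computed on them. It covers every numerator met below. *)
Definition expoly (R : realType) (a1 a0 b2 b1 b0 c4 c3 c2 c1 c0 x : R) : R :=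
  expR x ^+ 2 * (a1 * x + a0) + expR x * (b2 * x ^+ 2 + b1 * x + b0) +
  (c4 * x ^+ 4 + c3 * x ^+ 3 + c2 * x ^+ 2 + c1 * x + c0).

Lemma is_derive_expoly (R : realType) (a1 a0 b2 b1 b0 c4 c3 c2 c1 c0 x : R) :
  is_derive x 1 (expoly a1 a0 b2 b1 b0 c4 c3 c2 c1 c0)
    (expoly (2 * a1) (2 * a0 + a1) b2 (b1 + 2 * b2) (b0 + b1)
       0 (4 * c4) (3 * c3) (2 * c2) c1 x).
Proof.
rewrite /expoly.
apply: is_derive_eq.
rewrite /GRing.scale/=.
by ring.
Qed.

(* Iterated, this reduces positivity to that of the Taylor coefficients at 0. *)
Lemma expoly_gt0 (R : realType) (a1 a0 b2 b1 b0 c4 c3 c2 c1 c0 x : R) :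
  0 < x -> 0 <= a0 + b0 + c0 ->
  (forall z, 0 < z -> 0 < expoly (2 * a1) (2 * a0 + a1) b2 (b1 + 2 * b2)
       (b0 + b1) 0 (4 * c4) (3 * c3) (2 * c2) c1 z) ->
  0 < expoly a1 a0 b2 b1 b0 c4 c3 c2 c1 c0 x.
Proof.
move=> x0 h0 H.
set f := expoly a1 a0 b2 b1 b0 c4 c3 c2 c1 c0.
have f0 : 0 <= f 0 by rewrite /f /expoly expR0; lra.
apply: (le_lt_trans f0).
apply: (@lt_of_derive_gt0 _ f (expoly (2 * a1) (2 * a0 + a1) b2
  (b1 + 2 * b2) (b0 + b1) 0 (4 * c4) (3 * c3) (2 * c2) c1)) => // t.
  by move=> _; exact: is_derive_expoly.
by move=> /andP[/H].
Qed.

Lemma expR_gt_taylor2 (R : realType) (x : R) :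
  0 < x -> 1 + x + x ^+ 2 / 2 < expR x.
Proof.
move=> x0; have : 0 < expoly 0 0 0 0 1 0 0 (- (1 / 2)) (-1) (-1) x.
  do 3!(apply: (expoly_gt0 x0); [lra|move=> {x0}x x0]).
  by rewrite /expoly; have := expR_gt0 x; lra.
by rewrite /expoly; lra.
Qed.

(** Once the purely polynomial part has been differentiated away, a factor [exp x] comes out.
    Bounding the other one below by its quadratic Taylor polynomial leaves a cubic with nonnegative
    coefficients. *)
Lemma expoly_gt0_coef (R : realType) (a1 a0 b2 b1 b0 x : R) : 0 < x ->
  0 <= a0 -> 0 <= a1 -> 0 < a0 + b0 -> 0 <= a0 + a1 + b1 ->
  0 <= a0 / 2 + a1 + b2 ->
  0 < expoly a1 a0 b2 b1 b0 0 0 0 0 0 x.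
Proof.
move=> x0 a00 a10 h0 h1 h2; rewrite /expoly !mul0r !addr0.
have := expR_gt_taylor2 x0; set E := expR x => Ex.
have E0 : 0 < E by exact: expR_gt0.
have -> : E ^+ 2 * (a1 * x + a0) + E * (b2 * x ^+ 2 + b1 * x + b0) =
    E * ((E - (1 + x + x ^+ 2 / 2)) * (a1 * x + a0) +
     ((a0 + b0) + (a0 + a1 + b1) * x + (a0 / 2 + a1 + b2) * x ^+ 2 +
      a1 / 2 * x ^+ 3)) by field.
apply: mulr_gt0 => //; apply: ltr_wpDl.
  apply: mulr_ge0; first lra.
  by rewrite addr_ge0// mulr_ge0// ltW.
have xn n : 0 <= x ^+ n by rewrite exprn_ge0// ltW.
have := mulr_ge0 h1 (ltW x0); have := mulr_ge0 h2 (xn 2).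
have : 0 <= a1 / 2 by lra.
by move=> /mulr_ge0/(_ (xn 3)); lra.
Qed.

Lemma expR_gt_taylor4 (R : realType) (x : R) :
  0 < x -> 1 + x + x ^+ 2 / 2 + x ^+ 3 / 6 + x ^+ 4 / 24 < expR x.
Proof.
move=> x0.
have : 0 < expoly 0 0 0 0 1 (- (1 / 24)) (- (1 / 6)) (- (1 / 2)) (-1) (-1) x.
  do 5!(apply: (expoly_gt0 x0); [lra|move=> {x0}x x0]).
  by rewrite /expoly; have := expR_gt0 x; lra.
by rewrite /expoly; lra.
Qed.

(** This is the numerator of the difference in [downstep32_lt]. *)
Lemma expoly_down_mobius (R : realType) (x : R) : 0 < x ->
  0 < expR x ^+ 2 * (3 * x - 9 / 2) + expR x * (6 + 2 * x - 2 * x ^+ 2)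
      - 2 * x - 3 / 2.
Proof.
move=> x0.
have : 0 < expoly 3 (- (9 / 2)) (-2) 2 6 0 0 0 (-2) (- (3 / 2)) x.
  do 4!(apply: (expoly_gt0 x0); [lra|move=> {x0}x x0]).
  by rewrite !(mulr0, addr0, mul0r); apply: expoly_gt0_coef => //; lra.
by rewrite /expoly; lra.
Qed.

(** This is the numerator met in the first case of [overshoot_up_mobius]. *)
Lemma expoly_up_mobius (R : realType) (x : R) : 0 < x ->
  0 < expR x ^+ 2 * (2 * x - 3 / 2) + expR x * (6 - 2 * x - 2 * x ^+ 2)
      - 3 * x - 9 / 2.
Proof.
move=> x0.
have : 0 < expoly 2 (- (3 / 2)) (-2) (-2) 6 0 0 0 (-3) (- (9 / 2)) x.
  do 4!(apply: (expoly_gt0 x0); [lra|move=> {x0}x x0]).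
  by rewrite !(mulr0, addr0, mul0r); apply: expoly_gt0_coef => //; lra.
by rewrite /expoly; lra.
Qed.

Lemma expoly_elasticity (R : realType) (x : R) : 0 < x ->
  0 < 2 * expR x ^+ 2 + expR x * (- 4 + 2 * x - 3 * x ^+ 2)
      + 2 - 2 * x - x ^+ 2.
Proof.
move=> x0.
have : 0 < expoly 0 2 (-3) 2 (-4) 0 0 (-1) (-2) 2 x.
  do 5!(apply: (expoly_gt0 x0); [lra|move=> {x0}x x0]).
  by rewrite !(mulr0, addr0, mul0r); apply: expoly_gt0_coef => //; lra.
by rewrite /expoly; lra.
Qed.

(** For [x < 3], the [2/1] Padé approximant of [exp x] is an upper bound. *)
Lemma expR_pade21 (R : realType) (x : R) : 0 < x ->
  0 < expR x * (2 * x - 6) + 6 + 4 * x + x ^+ 2.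
Proof.
move=> x0.
have : 0 < expoly 0 0 0 2 (-6) 0 0 1 4 6 x.
  do 4!(apply: (expoly_gt0 x0); [lra|move=> {x0}x x0]).
  by rewrite !(mulr0, addr0, mul0r); apply: expoly_gt0_coef => //; lra.
by rewrite /expoly; lra.
Qed.

(** The [1/2] Padé approximant of [exp x] is a lower bound. *)
Lemma expR_pade12 (R : realType) (x : R) : 0 < x ->
  6 + 2 * x < expR x * (6 - 4 * x + x ^+ 2).
Proof.
move=> x0.
have : 0 < expoly 0 0 1 (-4) 6 0 0 0 (-2) (-6) x.
  do 4!(apply: (expoly_gt0 x0); [lra|move=> {x0}x x0]).
  by rewrite !(mulr0, addr0, mul0r); apply: expoly_gt0_coef => //; lra.
by rewrite /expoly; lra.
Qed.

(** Equivalent to [x < sinh x]. *)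
Lemma mul_expR_lt_sqr (R : realType) (x : R) : 0 < x ->
  2 * x * expR x < expR x ^+ 2 - 1.
Proof.
move=> x0.
have : 0 < expoly 0 1 0 (-2) 0 0 0 0 0 (-1) x.
  do 3!(apply: (expoly_gt0 x0); [lra|move=> {x0}x x0]).
  by rewrite !(mulr0, addr0, mul0r); apply: expoly_gt0_coef => //; lra.
by rewrite /expoly; lra.
Qed.

(** * The 2-cycle of F *)

(** For [z != 0], the mean of [exp v - 1] for [v] between 0 and [z]. *)
Definition expquot (R : realType) (z : R) : R := (expR z - 1 - z) / z.

Definition dexpquot (R : realType) (z : R) : R :=
  ((z - 1) * expR z + 1) / z ^+ 2.

Lemma is_derive_expquot (R : realType) (z : R) : z != 0 ->
  is_derive z 1 (@expquot R) (dexpquot z).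
Proof.
move=> z0; have dinv := is_deriveV z0 (is_derive_id z 1).
apply: is_derive_eq.
by rewrite /dexpquot /GRing.scale/=; field.
Qed.

Lemma dexpquot_gt0 (R : realType) (z : R) : z != 0 -> 0 < dexpquot z.
Proof.
move=> z0; rewrite divr_gt0 ?exprn_even_gt0 ?z0 ?orbT//.
have := @expR_gt1Dx R (- z); rewrite oppr_eq0 => /(_ z0).
rewrite -(ltr_pM2r (expR_gt0 z)) -expRD addNr expR0; lra.
Qed.

Lemma expquot_gt_half (R : realType) (z : R) : 0 < z -> z / 2 < expquot z.
Proof.
move=> z0; rewrite /expquot ltr_pdivlMr//.
have := expR_gt_taylor2 z0; lra.
Qed.

Lemma expquot_le (R : realType) (z : R) : 0 < z <= 1 / 2 ->
  expquot z <= 2 * z.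
Proof.
move=> /andP[z0 z1]; rewrite /expquot ler_pdivrMr//.
have := expR_ge1Dx (- z); rewrite -(ler_pM2r (expR_gt0 z)) -expRD addNr expR0.
by have := expR_gt0 z; nra.
Qed.

Lemma expquotN_gt (R : realType) (z : R) : 0 < z ->
  3 * z / (6 + 4 * z) < - expquot (- z).
Proof.
move=> z0; rewrite /expquot invrN mulrN opprK.
rewrite ltr_pdivrMr; last lra.
rewrite mulrAC ltr_pdivlMr// expRN.
have := expR_pade21 z0; set E := expR z => h.
have E0 : 0 < E by exact: expR_gt0.
have : (6 - 2 * z) < (6 + 4 * z + z ^+ 2) / E.
  by rewrite ltr_pdivlMr//; lra.
have : 0 < E^-1 by rewrite invr_gt0.
nra.
Qed.

Lemma expquotN_lt1 (R : realType) (z : R) : 0 < z -> - expquot (- z) < 1.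
Proof.
move=> z0; rewrite /expquot invrN mulrN opprK ltr_pdivrMr//.
have : expR (- z) < 1 by rewrite expR_lt1; lra.
lra.
Qed.

(** An elasticity bound: [z h'(z) / h(z) <= 1 + 2 h(z) / 3] for [h = expquot]. Clearing denominators
    leaves [expoly_elasticity]. *)
Lemma dexpquot_le (R : realType) (z : R) : 0 < z ->
  z * dexpquot z <= expquot z * (1 + 2 / 3 * expquot z).
Proof.
move=> z0; rewrite /dexpquot /expquot.
have := expoly_elasticity z0; set E := expR z => h.
rewrite -subr_ge0.
have -> : (E - 1 - z) / z * (1 + 2 / 3 * ((E - 1 - z) / z)) -
  z * (((z - 1) * E + 1) / z ^+ 2) = (2 * E ^+ 2 + E * (- 4 + 2 * z - 3 * z ^+ 2)
      + 2 - 2 * z - z ^+ 2) / (3 * z ^+ 2) by field; rewrite gt_eqF.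
by rewrite divr_ge0// ?ltW// mulr_gt0// exprn_gt0.
Qed.

(** The elasticity at [- z] is at most [1 / (1 + z / 3)], which is [expR_pade21] after clearing
    denominators. *)
Lemma dexpquotN_le (R : realType) (z : R) : 0 < z ->
  z * dexpquot (- z) * (1 + z / 3) <= - expquot (- z).
Proof.
move=> z0; rewrite /dexpquot /expquot.
have := expR_pade21 z0; rewrite expRN; set E := expR z => h.
have E0 : 0 < E by exact: expR_gt0.
rewrite -subr_ge0.
have -> : - ((E^-1 - 1 - - z) / - z) -
  z * (((- z - 1) * E^-1 + 1) / (- z) ^+ 2) * (1 + z / 3) =
  (E * (2 * z - 6) + 6 + 4 * z + z ^+ 2) / (3 * z * E).
  by field; rewrite !gt_eqF.
by rewrite divr_ge0// ?ltW// !mulr_gt0.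
Qed.

(* [ln (1 + F r y)], away from [y = 0]. *)
Definition logF (R : realType) (r y : R) : R := - r * expquot (r * y).

Lemma FE (R : realType) (r y : R) : r != 0 -> y != 0 ->
  F r y = expR (logF r y) - 1.
Proof.
move=> r0 y0; rewrite /F (negbTE y0) addrC; congr (expR _ - 1).
by rewrite /logF /expquot; field; rewrite r0 y0.
Qed.

Lemma subr_expRN_ge (R : realType) (w : R) : 0 < w ->
  w / (1 + w) <= 1 - expR (- w).
Proof.
move=> w0; rewrite expRN ler_pdivrMr; last lra.
have := expR_ge1Dx w; have := expR_gt0 w; set E := expR w => E0 Ew.
rewrite -(ler_pM2l E0) mulrA mulrBr divff ?gt_eqF// mulr1; nra.
Qed.

(* [{exp (-w) - 1, exp u - 1}] with [u, w > 0] is a 2-cycle of [F r] if and only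
   if [u = upstep r w] and [w = downstep r u]. *)
Definition upstep (R : realType) (r w : R) : R := logF r (expR (- w) - 1).
Definition downstep (R : realType) (r u : R) : R := - logF r (expR u - 1).

(** * Elasticities of the two steps and a fixed point of their composite *)

Section steps.
Context {R : realType} (r : R).
Hypothesis r0 : 0 < r.

Let Z (u : R) := r * (expR u - 1).
Let z (w : R) := r * (1 - expR (- w)).

Let Zgt0 (u : R) : 0 < u -> 0 < Z u.
Proof. by move=> u0; rewrite mulr_gt0// subr_gt0 expR_gt1. Qed.

Let zgt0 (w : R) : 0 < w -> 0 < z w.
Proof. by move=> w0; rewrite mulr_gt0// subr_gt0 expR_lt1; lra. Qed.

Let downstepE (u : R) : downstep r u = r * expquot (Z u).
Proof. by rewrite /downstep /logF mulNr opprK. Qed.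

Let upstepE (w : R) : upstep r w = r * - expquot (- z w).
Proof.
rewrite /upstep /logF mulNr -mulrN; congr (_ * - expquot _).
by rewrite /z; ring.
Qed.

Lemma downstep_gt (u : R) : 0 < u -> r * (r * (expR u - 1) / 2) < downstep r u.
Proof.
by move=> /Zgt0 Z0; rewrite downstepE ltr_pM2l//; exact: expquot_gt_half.
Qed.

Lemma downstep_gt0 (u : R) : 0 < u -> 0 < downstep r u.
Proof.
move=> u0; apply: lt_trans (downstep_gt u0).
by rewrite mulr_gt0// divr_gt0//; exact: Zgt0.
Qed.

Lemma upstep_lt (w : R) : 0 < w -> upstep r w < r.
Proof.
by move=> /zgt0 z0; rewrite upstepE gtr_pMr//; exact: expquotN_lt1.
Qed.

Let ddown (u : R) := r * (dexpquot (Z u) * (r * expR u)).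
Let dup (w : R) := r * (dexpquot (- z w) * (r * expR (- w))).

Lemma is_derive_downstep (u : R) : 0 < u -> is_derive u 1 (downstep r) (ddown u).
Proof.
move=> u0; rewrite (_ : downstep r = r \*o (@expquot R \o Z)); last first.
  by apply/funext => v; rewrite downstepE.
have dE : is_derive (Z u) 1 (@expquot R) (dexpquot (Z u)).
  by apply: is_derive_expquot; rewrite gt_eqF// Zgt0.
have dZ : is_derive u 1 Z (r * expR u).
  by apply: is_derive_eq; rewrite /GRing.scale/= subr0.
exact: is_deriveZ.
Qed.

Lemma is_derive_upstep (w : R) : 0 < w -> is_derive w 1 (upstep r) (dup w).
Proof.
move=> w0; rewrite (_ : upstep r = (- r) \*o (@expquot R \o (- z))); last first.
  by apply/funext => v; rewrite upstepE/= mulNr mulrN.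
have dE : is_derive ((- z) w) 1 (@expquot R) (dexpquot (- z w)).
  by apply: is_derive_expquot; rewrite oppr_eq0 gt_eqF// zgt0.
have dexp : is_derive w 1 (fun v => expR (- v)) (expR (- w) * -1).
  by apply: (@is_derive1_comp _ expR -%R).
have dz : is_derive w 1 (- z) (- (r * expR (- w))).
  rewrite (_ : - z = (- r) \*o (fun v => 1 - expR (- v))); last first.
    by apply/funext => v; rewrite /z/= mulNr.
  by apply: is_derive_eq; rewrite /GRing.scale/=; ring.
apply: is_derive_eq.
by rewrite /dup /GRing.scale/=; ring.
Qed.

Lemma downstep_lt (u v : R) : 0 < u -> u < v -> downstep r u < downstep r v.
Proof.
move=> u0 uv; apply: (@lt_of_derive_gt0 _ (downstep r) ddown _ _ uv) => t.
  by move=> /andP[ut _]; apply: is_derive_downstep; exact: lt_le_trans ut.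
move=> /andP[ut _]; apply: (mulr_gt0 r0); apply: mulr_gt0.
  by apply: dexpquot_gt0; rewrite gt_eqF// Zgt0// (lt_trans u0).
by apply: (mulr_gt0 r0); exact: expR_gt0.
Qed.

Hypothesis r32 : 3 / 2 <= r.

Let r2 : 9 / 4 <= r * r.
Proof. by move: (r32) => ?; nra. Qed.

(* The proof gives the factors [1 + 2w/(3r)] and [1 + w/r^2], with
   [w = downstep r u]; both are at most [1 + 4w/9] since [r >= 3/2]. *)
Let ddown_le (u : R) : 0 < u -> u * ddown u <=
  downstep r u * (1 + 4 / 9 * downstep r u) ^+ 2.
Proof.
move: (r0) (r32) => ? ?.
move=> u0; rewrite downstepE /ddown.
have Z0 := Zgt0 u0.
have := dexpquot_le Z0; have := expquot_gt_half Z0.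
have := dexpquot_gt0 (lt0r_neq0 Z0).
set h := expquot _; set d := dexpquot _ => d0 hZ dh.
have uZ : u * (r * expR u) <= Z u * (1 + h / r).
  have E0 : 0 < expR u - 1 by rewrite subr_gt0 expR_gt1.
  have : u * expR u <= (expR u - 1) * (1 + (expR u - 1) / 2).
    by have := mul_expR_lt_sqr u0; lra.
  rewrite -(ler_pM2l r0) => /le_trans h1.
  rewrite mulrCA; apply: h1; rewrite mulrA -/(Z u) ler_pM2l// lerD2l.
  by rewrite ler_pdivlMr//; move: hZ; rewrite /Z; lra.
have h0 : 0 < h by apply: lt_trans hZ; rewrite divr_gt0.
have -> : u * (r * (d * (r * expR u))) = r * d * (u * (r * expR u)) by ring.
apply: (@le_trans _ _ (r * d * (Z u * (1 + h / r)))).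
  by rewrite ler_pM2l// mulr_gt0.
have -> : r * d * (Z u * (1 + h / r)) = r * ((Z u * d) * (1 + h / r)) by ring.
rewrite -[leRHS]mulrA ler_pM2l//.
have hr : h / r <= 4 / 9 * (r * h).
  by rewrite ler_pdivrMr//; move: r2 => /(ler_wpM2r (ltW h0)); lra.
have h23 : 2 / 3 * h <= 4 / 9 * (r * h) by nra.
apply: (@le_trans _ _ (h * (1 + 2 / 3 * h) * (1 + h / r))).
  by apply: ler_wpM2r => //; rewrite addr_ge0// divr_ge0// ltW.
have hr0 : 0 <= h / r by exact: divr_ge0 (ltW h0) (ltW r0).
rewrite -[leLHS]mulrA ler_pM2l// expr2.
by apply: ler_pM; rewrite ?lerD2l//; lra.
Qed.

(** Since [r exp (- w) (exp w - 1) = z w], this is [dexpquotN_le]. The elasticity of [upstep] at [w]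
    is thus at most [w / ((exp w - 1) (1 + z w / 3))]. *)
Let dup_le (w : R) : 0 < w ->
  dup w * ((expR w - 1) * (1 + z w / 3)) <= upstep r w.
Proof.
move: (r0) (r32) => ? ?.
move=> w0; rewrite upstepE /dup.
have z0 := zgt0 w0; have := dexpquotN_le z0.
set d := dexpquot _; set h := expquot _ => dh.
have -> : r * (d * (r * expR (- w))) * ((expR w - 1) * (1 + z w / 3)) =
    r * (z w * d * (1 + z w / 3)).
  by rewrite /z expRN; field; rewrite gt_eqF// expR_gt0.
by rewrite ler_pM2l.
Qed.

(** This says that the elasticity bounds of [ddown_le] and [dup_le] have a product less than 1. *)
Let step_ineq (w : R) : 0 < w ->
  w * (1 + 4 / 9 * w) ^+ 2 < (expR w - 1) * (1 + z w / 3).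
Proof.
move: (r0) (r32) => ? ?.
move=> w0.
have z3 : w / (2 * (1 + w)) <= z w / 3.
  have := subr_expRN_ge w0.
  have -> : w / (2 * (1 + w)) = w / (1 + w) / 2 by field; lra.
  rewrite /z; set e := expR _ => h.
  have : 0 <= w / (1 + w) by apply: divr_ge0; lra.
  nra.
have := expR_gt_taylor4 w0; set E := expR w => Ew.
apply: (@lt_le_trans _ _ ((E - 1) * (1 + w / (2 * (1 + w))))); last first.
  have E1 : 0 < E - 1 by rewrite subr_gt0 expR_gt1.
  by rewrite ler_pM2l// lerD2l.
have -> : 1 + w / (2 * (1 + w)) = (1 + 3 / 2 * w) / (1 + w) by field; lra.
rewrite [ltRHS]mulrA ltr_pdivlMr; last lra.
apply: (@lt_trans _ _ ((w + w ^+ 2 / 2 + w ^+ 3 / 6 + w ^+ 4 / 24) *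
  (1 + 3 / 2 * w))); last first.
  by rewrite ltr_pM2r; lra.
rewrite -subr_gt0.
have -> : (w + w ^+ 2 / 2 + w ^+ 3 / 6 + w ^+ 4 / 24) * (1 + 3 / 2 * w) -
  w * (1 + 4 / 9 * w) ^+ 2 * (1 + w) =
  w ^+ 2 * (1 / 9 - 55 / 324 * w + 61 / 648 * w ^+ 2 + w ^+ 3 / 16) by field.
apply: mulr_gt0; first exact: exprn_gt0.
(* The remaining quadratic in [w] has negative discriminant. *)
have : 0 < w ^+ 3 / 16 by rewrite divr_gt0 ?exprn_gt0.
nra.
Qed.

(** The derivative of the ratio has the sign of the elasticity of the composite minus 1, and
    elasticities multiply under composition. *)
Lemma step_ratio_decr (u v : R) : 0 < u -> u < v ->
  upstep r (downstep r v) / v < upstep r (downstep r u) / u.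
Proof.
move=> u0 uv.
pose w := downstep r.
pose f := (upstep r \o w) \* (fun t => t^-1).
pose df t := (upstep r \o w) t * (- t ^- 2) + t^-1 * (dup (w t) * ddown t).
change (f v < f u).
apply: (lt_of_derive_lt0 (df := df) uv) => t /andP[ut _].
  have t0 : 0 < t by exact: lt_le_trans ut.
  have dinv : is_derive t 1 (fun t : R => t^-1) (- t ^- 2).
    have := is_deriveV (lt0r_neq0 t0) (is_derive_id t 1).
    by rewrite /GRing.scale/= mulr1.
  have dc : is_derive t 1 (upstep r \o w) (dup (w t) * ddown t).
    apply: is_derive1_comp; last exact: is_derive_downstep.
    by apply: is_derive_upstep; exact: downstep_gt0.
  exact: is_deriveM.
have t0 : 0 < t by exact: lt_trans ut.
have w0 : 0 < w t by exact: downstep_gt0.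
rewrite /df/=.
have -> : upstep r (w t) * - t ^- 2 + t^-1 * (dup (w t) * ddown t) =
  (dup (w t) * (t * ddown t) - upstep r (w t)) / t ^+ 2.
  by field; rewrite gt_eqF.
rewrite pmulr_llt0 ?invr_gt0 ?exprn_gt0// subr_lt0.
have dup0 : 0 < dup (w t).
  apply: (mulr_gt0 r0); apply: mulr_gt0.
    by apply: dexpquot_gt0; rewrite oppr_eq0 gt_eqF// zgt0.
  by apply: (mulr_gt0 r0); exact: expR_gt0.
apply: lt_le_trans (dup_le w0); rewrite ltr_pM2l//.
exact: le_lt_trans (ddown_le t0) (step_ineq w0).
Qed.

(** The composite has slope [r ^ 4 / 4 > 1] at 0 and stays below [r], so it crosses the diagonal. *)
Lemma step_fixpoint_exists :
  exists2 u0, 0 < u0 & upstep r (downstep r u0) = u0.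
Proof.
move: (r0) (r32) => ? ?.
(* Small enough that [w <= r / 16] below, which gives [12 + (12 + 8 r) w < 3 r ^ 4]. *)
pose Z1 : R := 1 / 32.
pose u1 := ln (1 + Z1 / r).
have Z1r : 0 < Z1 / r by rewrite divr_gt0// /Z1; lra.
have u10 : 0 < u1 by rewrite ln_gt0// ltrDl.
have Zu1 : Z u1 = Z1.
  by rewrite /Z /u1 lnK ?posrE; [field; rewrite gt_eqF|lra].
have big : u1 < upstep r (downstep r u1).
  set w := downstep r u1.
  have w0 : 0 < w by exact: downstep_gt0.
  have w1 : w <= r / 16.
    rewrite /w downstepE Zu1 ler_pM2l//.
    have := @expquot_le _ Z1; rewrite /Z1 => /(_ _)/le_trans; apply; lra.
  (* It now suffices that [upstep r w] exceeds [2 w / r ^ 2]. *)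
  have uw : u1 <= 2 / r ^+ 2 * w.
    have : r * (Z1 / 2) < w by rewrite -Zu1; exact: downstep_gt.
    have : u1 <= Z1 / r by apply: le_ln1Dx; lra.
    have -> : 2 / r ^+ 2 * w = 2 * w / r / r by field; rewrite gt_eqF.
    move=> h1 h2; apply: (le_trans h1); rewrite ler_pM2r ?invr_gt0//.
    by rewrite ler_pdivlMr//; lra.
  apply: (le_lt_trans uw); rewrite upstepE.
  have z0 := zgt0 w0.
  apply: (@lt_trans _ _ (r * (3 * z w / (6 + 4 * z w)))); last first.
    by rewrite ltr_pM2l//; exact: expquotN_gt.
  have zw : r * w / (1 + w) <= z w.
    by rewrite -mulrA ler_pM2l//; exact: subr_expRN_ge.
  (* As [3 z / (6 + 4 z)] increases with [z], the lower bound [r w / (1 + w)] may replace [z w]. *)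
  apply: (@lt_le_trans _ _ (r * (3 * (r * w) / (6 + (6 + 4 * r) * w)))).
    have -> : 2 / r ^+ 2 * w = r * (2 / r ^+ 3 * w) by field; rewrite gt_eqF.
    rewrite ltr_pM2l// ltr_pdivlMr; last nra.
    rewrite -subr_gt0.
    have -> : 3 * (r * w) - 2 / r ^+ 3 * w * (6 + (6 + 4 * r) * w) =
       w / r ^+ 3 * (3 * r ^+ 4 - 12 - (12 + 8 * r) * w).
      by field; rewrite gt_eqF.
    rewrite mulr_gt0 ?divr_gt0 ?exprn_gt0// subr_gt0.
    have r4 : 9 / 4 * r ^+ 2 <= r ^+ 4.
      by rewrite (exprM _ 2 2) expr2 ler_wpM2r// sqr_ge0.
    have : (12 + 8 * r) * w <= (12 + 8 * r) * (r / 16).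
      by rewrite ler_wpM2l//; lra.
    nra.
  rewrite ler_pM2l// ler_pdivrMr; last nra.
  rewrite mulrAC ler_pdivlMr; last lra.
  move: zw; rewrite ler_pdivrMr; last lra.
  nra.
have small : upstep r (downstep r r) < r.
  by apply: upstep_lt => //; exact: downstep_gt0.
have u1r : u1 <= r.
  apply: ltW; apply: (lt_trans big); apply: upstep_lt => //.
  exact: downstep_gt0.
have cf : {within `[u1, r], continuous (fun t => upstep r (downstep r t) - t)}.
  apply: (@is_derive_within _ _ (fun t => dup (downstep r t) * ddown t - 1)).
  move=> t /andP[ut _]; have t0 : 0 < t by exact: lt_le_trans ut.
  have dc : is_derive t 1 (upstep r \o downstep r) (dup (downstep r t) * ddown t).
    apply: is_derive1_comp; last exact: is_derive_downstep.
    by apply: is_derive_upstep; exact: downstep_gt0.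
  exact: is_deriveB.
have [|u0 uI E] := IVT u1r cf (v := 0).
  by rewrite ge_min le_max !subr_ge0 !subr_le0 (ltW small) (ltW big) orbT.
exists u0; last by apply/eqP; rewrite -subr_eq0 E.
by move: uI; rewrite in_itv/= => /andP[/(lt_le_trans u10)].
Qed.

End steps.

(** * From fixed points of the composite step to 2-cycles of [F] *)

Lemma F_upstep (R : realType) (r w : R) : 0 < r -> 0 < w ->
  F r (expR (- w) - 1) = expR (upstep r w) - 1.
Proof.
move=> r0 w0; rewrite FE ?(lt0r_neq0 r0)//.
by rewrite ltr0_neq0// subr_lt0 expR_lt1 oppr_lt0.
Qed.

Lemma F_downstep (R : realType) (r u : R) : 0 < r -> 0 < u ->
  F r (expR u - 1) = expR (- downstep r u) - 1.
Proof.
move=> r0 u0; rewrite FE ?(lt0r_neq0 r0) ?lt0r_neq0// ?subr_gt0 ?expR_gt1//.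
by rewrite /downstep opprK.
Qed.

Lemma F_lt0 (R : realType) (r y : R) : 0 < r -> 0 < y -> F r y < 0.
Proof.
move=> r0 y0; have -> : y = expR (ln (1 + y)) - 1 by rewrite lnK ?posrE; lra.
have u0 : 0 < ln (1 + y) by rewrite ln_gt0// ltrDl.
rewrite F_downstep// subr_lt0 expR_lt1 oppr_lt0; exact: downstep_gt0.
Qed.

Lemma F_gt0 (R : realType) (r y : R) : 0 < r -> y < 0 -> 0 < F r y.
Proof.
move=> r0 y0; rewrite FE ?(lt0r_neq0 r0) ?ltr0_neq0// subr_gt0 expR_gt1.
rewrite /logF mulNr -mulrN mulr_gt0//.
have z0 : 0 < r * - y by rewrite mulr_gt0// oppr_gt0.
have := expquotN_gt z0; rewrite (_ : - (r * - y) = r * y); last ring.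
apply: lt_trans.
by apply: divr_gt0; lra.
Qed.

(** [F] exchanges the signs, so a 2-cycle has one negative and one positive point. The latter gives
    a fixed point of the composite step, where a strictly decreasing ratio equals 1. *)
Lemma two_cycle_unique (R : realType) (r u0 : R) : 3 / 2 <= r -> 0 < u0 ->
  upstep r (downstep r u0) = u0 ->
  unique (two_cycle (F r)) [set expR (- downstep r u0) - 1; expR u0 - 1].
Proof.
move=> r32 u0_gt0 fixu0; have r0 : 0 < r by lra.
have key (a b : R) : a < 0 -> 0 < b -> F r a = b -> F r b = a ->
    a = expR (- downstep r u0) - 1 /\ b = expR u0 - 1.
  move=> a0 b0 Fa Fb; pose u := ln (1 + b).
  have u_gt0 : 0 < u by rewrite ln_gt0// ltrDl.
  have bE : b = expR u - 1 by rewrite lnK ?posrE; lra.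
  have aE : a = expR (- downstep r u) - 1 by rewrite -Fb bE F_downstep.
  have fixu : upstep r (downstep r u) = u.
    apply: expR_inj; apply: (addIr (-1)).
    by rewrite -F_upstep ?downstep_gt0// -aE Fa.
  suff uE : u = u0 by rewrite aE bE uE.
  have [uu0|u0u|//] := ltgtP u u0.
    have := step_ratio_decr r0 r32 u_gt0 uu0.
    by rewrite fixu fixu0 !divff ?gt_eqF// ltxx.
  have := step_ratio_decr r0 r32 u0_gt0 u0u.
  by rewrite fixu fixu0 !divff ?gt_eqF// ltxx.
split.
  exists (expR (- downstep r u0) - 1), (expR u0 - 1); split=> //.
  - have : expR (- downstep r u0) < 1.
      by rewrite expR_lt1 oppr_lt0; exact: downstep_gt0.
    have := pexpR_gt1 u0_gt0 => ? ?; rewrite lt_eqF//; lra.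
  - by rewrite F_upstep ?downstep_gt0// fixu0.
  - by rewrite F_downstep.
move=> C [a [b [ab Fa Fb ->]]].
have [a0|a0|a0] := ltgtP a 0.
- have b0 : 0 < b by rewrite -Fa F_gt0.
  by have [-> ->] := key _ _ a0 b0 Fa Fb.
- have b0 : b < 0 by rewrite -Fa F_lt0.
  by have [-> ->] := key _ _ b0 a0 Fb Fa; rewrite setUC.
- by move: ab; rewrite -Fa a0 /F !eqxx.
Qed.

(** * Solutions of Wright's equation *)

(* For a solution [y] of Wright's equation, both [ln (1 + y)] (with [s = 1])
   and [- ln (1 + y)] (with [s = -1]) solve this equation, so that each estimate
   from above also yields one from below. *)
Definition signed_wright (R : realType) (r s : R) (x : R -> R) : Prop :=
  forall t : R, 1 < t ->
    is_derive t 1 x (- r * (s * (expR (s * x (t - 1)) - 1))).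

(* The integral over [v] in [0, 1] of [c s (1 - e^(- s c a v))] for [v < T] and
   of [c a] for [v > T]. *)
Definition overshoot (R : realType) (c s a T : R) : R :=
  c * a * (1 - T) + c * s * T - (1 - expR (- (s * (c * a * T)))) / a.

Definition ev_le (R : realType) (f : R -> R) (u : R) : Prop :=
  exists T, forall t, T <= t -> f t <= u.

(** The zero is the supremum of the points of [a, b] where [f <= 0]. *)
Lemma last_zero (R : realType) (f : R -> R) (a b : R) : a <= b ->
  (forall v, a <= v <= b -> {for v, continuous f}) -> f a <= 0 -> 0 < f b ->
  exists c, [/\ a <= c <= b, f c = 0 & forall v, c <= v <= b -> 0 <= f v].
Proof.
move=> ab cf fa fb.
pose E := [set v | a <= v <= b /\ f v <= 0].
have Ea : E a by split; rewrite ?lexx.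
have Eb : ubound E b by move=> v [/andP[]].
have supE : has_sup E by split; [exists a|exists b].
pose c := sup E.
have ac : a <= c by apply: ub_le_sup => //; exists b.
have cb : c <= b by apply: ge_sup => //; exists a.
have acb : a <= c <= b by rewrite ac.
have post v : c < v -> v <= b -> 0 < f v.
  move=> cv vb; rewrite ltNge; apply/negP => fv.
  have : v <= c.
    by apply: ub_le_sup; [exists b|split=> //; rewrite vb (le_trans ac)// ltW].
  by rewrite leNgt cv.
have fc_ge : 0 <= f c.
  move: cb; rewrite le_eqVlt => /predU1P[->|cb]; first exact: ltW.
  rewrite leNgt; apply/negP => fc0.
  have [e /= e0 He] := cvgr_lt _ (cf _ acb) _ fc0.
  pose v := Num.min b (c + e / 2).
  have cv : c < v by rewrite lt_min cb ltrDl divr_gt0.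
  have vb : v <= b by rewrite ge_min lexx.
  have := post _ cv vb; rewrite ltNge => /negP; apply; apply/ltW/He => /=.
  rewrite distrC gtr0_norm ?subr_gt0// ltrBlDl.
  rewrite (@le_lt_trans _ _ (c + e / 2)) ?ge_min ?lexx ?orbT//; lra.
have fc_le : f c <= 0.
  rewrite leNgt; apply/negP => fc0.
  have [e /= e0 He] := cvgr_gt _ (cf _ acb) _ fc0.
  have [v [/andP[av vb] fv] cev] := sup_adherent e0 supE.
  have vc : v <= c by apply: ub_le_sup; [exists b|split=> //; rewrite av].
  have : 0 < f v.
    by apply: He => /=; rewrite ger0_norm ?subr_ge0// ltrBlDr -ltrBlDl.
  by rewrite ltNge fv.
have fc : f c = 0 by apply/eqP; rewrite eq_le fc_le.
exists c; split=> // v /andP[]; rewrite le_eqVlt => /predU1P[<-|cv vb].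
  by rewrite fc.
exact/ltW/post.
Qed.

(** * Bounds on a solution after one of its zeros *)

Section signed_wright.
Context {R : realType} (r s : R) (x : R -> R).
Hypothesis r0 : 0 < r.
Hypothesis s1 : s = 1 \/ s = -1.
Hypothesis xE : signed_wright r s x.

(** The equation reads [x'(t) = - r phi (x (t - 1))]; for both values of [s], [phi] is increasing
    and vanishes at 0. *)
Let phi (z : R) : R := s * (expR (s * z) - 1).

Let phi_le (z1 z2 : R) : z1 <= z2 -> phi z1 <= phi z2.
Proof.
rewrite /phi; case: s1 => ->; rewrite ?mul1r ?mulN1r ?lerN2 lerD2r ler_expR//.
by rewrite lerN2.
Qed.

Let phi0 : phi 0 = 0.
Proof. by rewrite /phi mulr0 expR0 subrr mulr0. Qed.

Let phi_gt0 (z : R) : 0 < z -> 0 < phi z.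
Proof.
rewrite /phi; case: s1 => -> z0; rewrite ?mul1r ?mulN1r ?oppr_gt0.
  by rewrite subr_gt0 expR_gt1.
by rewrite subr_lt0 expR_lt1 oppr_lt0.
Qed.

Let xc (t : R) : 1 < t -> {for t, continuous x}.
Proof. by move=> /xE/is_derive_continuous. Qed.

Lemma overshoot_ge0 (c a T : R) : 0 < c -> 0 < a -> 0 <= T <= 1 ->
  c * a * (1 - T) <= overshoot c s a T.
Proof.
move=> c0 a0 T01; rewrite /overshoot -addrA lerDl subr_ge0 ler_pdivrMr//.
have := expR_ge1Dx (- (s * (c * a * T))); lra.
Qed.

Section bound.
(** Allowing [c >= r] lets part (a) work with [c = 3/2] throughout. The slope bound holds one delay
    after [t0], hence on [xi - 1, xi] when [xi >= t0 + 2]. *)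
Variables (c a T t0 xi : R).
Hypotheses (rc : r <= c) (a0 : 0 < a) (T01 : 0 <= T <= 1) (t00 : 0 < t0).
Hypothesis phi_ge : forall t, t0 <= t -> - a <= phi (x t).
Hypotheses (t0xi : t0 + 2 <= xi) (xxi : x xi = 0).

Let c0 : 0 < c. Proof. exact: lt_le_trans rc. Qed.

Let dx_le (t : R) : t0 <= t -> - r * phi (x t) <= c * a.
Proof.
move=> /phi_ge h; have : r * a <= c * a by rewrite ler_wpM2r// ltW.
by apply: le_trans; rewrite mulNr -mulrN ler_pM2l//; lra.
Qed.

Let x_lip (u v : R) : t0 + 1 <= u -> u <= v -> x v - x u <= c * a * (v - u).
Proof.
move=> t0u uv; move: (t00) => ?.
suff : x v - c * a * v <= x u - c * a * u by lra.
apply: (@le_of_derive_le0 _ (fun t => x t - c * a * t)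
  (fun t => - r * phi (x (t - 1)) - c * a)) => // t /andP[ut tv].
  have dxt : is_derive t 1 x (- r * phi (x (t - 1))) by apply: xE; lra.
  have dl : is_derive t 1 (fun t : R => c * a * t) (c * a).
    by apply: is_derive_eq; rewrite /GRing.scale/=; ring.
  exact: is_deriveB.
by rewrite subr_le0; apply: dx_le; lra.
Qed.

(** The slope bound, run backwards from the zero [xi], bounds [x (t - 1)] below; [phi] is
    increasing, and nonpositive at this bound, so [c] may replace [r]. *)
Let dx_le' (t : R) : xi <= t <= xi + 1 ->
  - r * phi (x (t - 1)) <= - c * phi (- (c * a * (xi + 1 - t))).
Proof.
move=> /andP[xit txi]; move: (t00) (t0xi) => ? ?.
set m := c * a * (xi + 1 - t).
have m0 : 0 <= m by rewrite !mulr_ge0// ?(ltW c0) ?(ltW a0)//; lra.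
have xm : - m <= x (t - 1).
  have := @x_lip (t - 1) xi; rewrite xxi /m => h.
  have {}h : 0 - x (t - 1) <= c * a * (xi - (t - 1)) by apply: h; lra.
  lra.
have pm : phi (- m) <= 0 by rewrite -phi0 phi_le//; lra.
have h1 : - r * phi (x (t - 1)) <= - r * phi (- m).
  by rewrite !mulNr lerN2 ler_pM2l//; exact: phi_le.
apply: (le_trans h1); rewrite !mulNr lerN2.
by rewrite ler_wnM2r.
Qed.

(** The linear bound is used up to time [xi + 1 - T] and the exponential one afterwards, with
    primitive [G]. *)
Let x_le (t : R) : xi <= t <= xi + 1 -> x t <= overshoot c s a T.
Proof.
move=> /andP[xit txi]; move: (t00) (t0xi) (T01) => ? ? /andP[T0 T1].
have ca : 0 < c * a by rewrite mulr_gt0.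
have lin (v : R) : xi <= v -> x v <= c * a * (v - xi).
  by move=> xiv; have := @x_lip xi v; rewrite xxi subr0; apply; lra.
have [tp|pt] := leP t (xi + 1 - T).
  apply: (@le_trans _ _ (c * a * (1 - T))); last exact: overshoot_ge0.
  by apply: (le_trans (lin _ xit)); rewrite ler_pM2l//; lra.
pose p := xi + 1 - T.
have xp : x p <= c * a * (1 - T).
  by have := lin p; rewrite (_ : p - xi = 1 - T) /p; [apply; lra|lra].
pose G v := c * s * v - expR (- (s * (c * a * (xi + 1 - v)))) / a.
have dG (v : R) : is_derive v 1 G (- c * phi (- (c * a * (xi + 1 - v)))).
  have de : is_derive v 1 (fun v => expR (- (s * (c * a * (xi + 1 - v)))))
     (expR (- (s * (c * a * (xi + 1 - v)))) * (s * (c * a))).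
    apply: (@is_derive1_comp _ expR (fun v => - (s * (c * a * (xi + 1 - v))))).
    by apply: is_derive_eq; rewrite /GRing.scale/=; ring.
  apply: is_derive_eq.
  rewrite /GRing.scale/= /phi mulrN; field; exact: lt0r_neq0.
have GE : G (xi + 1) - G p = c * s * T - (1 - expR (- (s * (c * a * T)))) / a.
  rewrite /G /p (_ : xi + 1 - (xi + 1) = 0); last by ring.
  rewrite (_ : xi + 1 - (xi + 1 - T) = T); last by ring.
  by rewrite !mulr0 oppr0 expR0; ring.
have Gt : G t <= G (xi + 1).
  apply: (@le_of_derive_ge0 _ G _ _ _ txi (fun v _ => dG v)) => v /andP[tv vxi].
  rewrite mulNr oppr_ge0 pmulr_rle0// -phi0 phi_le// oppr_le0 mulr_ge0// ?ltW//.
  by rewrite subr_gt0.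
have : x t - G t <= x p - G p.
  apply: (@le_of_derive_le0 _ (fun v => x v - G v) (fun v =>
    - r * phi (x (v - 1)) - (- c * phi (- (c * a * (xi + 1 - v)))))) => //.
  - exact: ltW.
  - move=> v /andP[pv vt]; apply: is_deriveB; apply: xE; rewrite /p in pv; lra.
  - by move=> v /andP[pv vt]; rewrite subr_le0 dx_le'//; rewrite /p in pv; lra.
rewrite /overshoot; lra.
Qed.

(** After [xi + 1] the delayed value is nonnegative, so [x] no longer increases. *)
Lemma le_overshoot (t : R) : xi <= t -> (forall v, xi <= v <= t -> 0 <= x v) ->
  x t <= overshoot c s a T.
Proof.
move=> xit xpos; have [txi|xit1] := leP t (xi + 1); first by rewrite x_le ?xit.
move: (t00) (t0xi) => ? ?.
apply: (@le_trans _ _ (x (xi + 1))); last by apply: x_le; lra.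
apply: (@le_of_derive_le0 _ x (fun t => - r * phi (x (t - 1)))) => //.
- exact: ltW.
- by move=> v /andP[xiv vt]; apply: xE; lra.
- move=> v /andP[xiv vt]; rewrite mulNr oppr_le0.
  apply: mulr_ge0; first exact: ltW.
  by rewrite -phi0 phi_le// xpos//; lra.
Qed.

End bound.

Lemma ev_le_overshoot (c a T t0 : R) : r <= c -> 0 < a -> 0 <= T <= 1 ->
  (forall t, t0 <= t -> - a <= phi (x t)) ->
  (forall t1, exists2 t, t1 <= t & x t <= 0) ->
  ev_le x (overshoot c s a T).
Proof.
move=> rc a0 T01 phi_ge osc; have c0 : 0 < c by exact: lt_le_trans rc.
pose t1 := Num.max t0 1.
have t10 : 0 < t1 by rewrite lt_max ltr01 orbT.
have t1_ge : 1 <= t1 by rewrite le_max lexx orbT.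
have t01 : t0 <= t1 by rewrite le_max lexx.
have [b b_ge xb] := osc (t1 + 2).
exists b => t bt; have [xt|xt] := leP (x t) 0.
  apply: (le_trans xt); apply: le_trans (overshoot_ge0 c0 a0 T01).
  by case/andP: T01 => *; rewrite !mulr_ge0// ?subr_ge0// ltW.
have [|xi [/andP[bxi xit] xxi xpos]] := @last_zero _ x b t bt _ xb xt.
  by move=> v /andP[bv _]; apply: xc; lra.
apply: (@le_overshoot c a T t1 xi) => //; last lra.
by move=> v t1v; apply: phi_ge; lra.
Qed.

(** A positive [x] eventually decreases, and while it exceeds [e] its slope is at most
    [- r phi e]. *)
Lemma positive_to0 (t0 : R) : (forall t, t0 <= t -> 0 < x t) ->
  forall e, 0 < e -> ev_le x e.
Proof.
move=> xpos e e0.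
pose t1 := Num.max t0 1 + 1.
have t1_ge : 2 <= t1 by rewrite /t1 -[2]/(1 + 1) lerD2r le_max lexx orbT.
have t01 : t0 + 1 <= t1 by rewrite lerD2r le_max lexx.
have dec (u v : R) : t1 <= u -> u <= v -> x v <= x u.
  move=> t1u uv.
  apply: (@le_of_derive_le0 _ x (fun t => - r * phi (x (t - 1)))) => //.
    by move=> w /andP[uw _]; apply: xE; lra.
  move=> w /andP[uw _]; rewrite mulNr oppr_le0; apply: mulr_ge0; first exact: ltW.
  by apply/ltW/phi_gt0/xpos; lra.
have k0 : 0 < r * phi e by rewrite mulr_gt0// phi_gt0.
(* The time when the line of slope [- r phi e] from [x (t1 + 1)] reaches 0. *)
pose t2 := t1 + 1 + x (t1 + 1) / (r * phi e).
have xt1 : 0 < x (t1 + 1) by apply: xpos; lra.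
have t12 : t1 + 1 <= t2 by rewrite lerDl divr_ge0// ltW.
have [xe|ex] := leP (x t2) e.
  by exists t2 => t t2t; apply: (le_trans _ xe); apply: dec => //; lra.
suff : x t2 + r * phi e * t2 <= x (t1 + 1) + r * phi e * (t1 + 1).
  have -> : r * phi e * t2 = r * phi e * (t1 + 1) + x (t1 + 1).
    by rewrite /t2 mulrDr; congr (_ + _); rewrite mulrC divfK// gt_eqF.
  lra.
apply: (@le_of_derive_le0 _ (fun t => x t + r * phi e * t)
  (fun t => - r * phi (x (t - 1)) + r * phi e)) => //.
  move=> t /andP[tt _].
  have dxt : is_derive t 1 x (- r * phi (x (t - 1))) by apply: xE; lra.
  have dl : is_derive t 1 (fun t : R => r * phi e * t) (r * phi e).
    by apply: is_derive_eq; rewrite /GRing.scale/=; ring.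
  exact: is_deriveD.
move=> t /andP[tt tt2]; rewrite mulNr addrC subr_le0 ler_pM2l//; apply: phi_le.
by apply: (le_trans (ltW ex)); apply: dec; lra.
Qed.

End signed_wright.

(** * The upper and lower limits of the logarithm *)

Lemma limsup_exists (R : realType) (f : R -> R) (u : R) : ev_le f u ->
  (forall t1, exists2 t, t1 <= t & 0 <= f t) ->
  exists U, [/\ 0 <= U, forall v, U < v -> ev_le f v &
    forall v, ev_le f v -> U <= v].
Proof.
move=> fu osc; pose E := [set v | ev_le f v].
have E0 : lbound E 0.
  by move=> v [T HT]; have [t Tt ft] := osc T; apply: (le_trans ft); exact: HT.
have infE : has_inf E by split; [exists u|exists 0].
exists (inf E); split.
- by apply: lb_le_inf => //; exists u.
- move=> v /(inf_lt infE.1)[v' [T HT] v'v].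
  by exists T => t /HT /le_trans; apply; exact: ltW.
- by move=> v Ev; apply: ge_inf => //; exists 0.
Qed.

(** If [x] eventually keeps a sign, it tends to 0 and [U = W = 0] works because overshoots are
    nonnegative. Otherwise each eventual bound on one side yields an overshoot bound on the
    other. *)
Lemma wright_limits (R : realType) (r : R) (x : R -> R) : 0 < r ->
  signed_wright r 1 x -> signed_wright r (-1) (fun t => - x t) ->
  exists U W : R, [/\ 0 <= U, 0 <= W,
    forall u, U < u -> ev_le x u, forall w, W < w -> ev_le (fun t => - x t) w &
    forall c T, r <= c -> 0 <= T <= 1 ->
      (forall w, W < w -> U <= overshoot c 1 (1 - expR (- w)) T) /\
      (forall u, U < u -> W <= overshoot c (-1) (expR u - 1) T)].
Proof.
move=> r0 xE NxE.
have one : 1 = 1 :> R \/ 1 = -1 :> R by left.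
have mone : -1 = 1 :> R \/ -1 = -1 :> R by right.
have a1_gt0 (w : R) : 0 < w -> 0 < 1 - expR (- w).
  by move=> w0; rewrite subr_gt0 expR_lt1 oppr_lt0.
have a2_gt0 (u : R) : 0 < u -> 0 < expR u - 1.
  by move=> u0; rewrite subr_gt0 expR_gt1.
have os0 (s c a T : R) : r <= c -> 0 < a -> 0 <= T <= 1 -> 0 <= overshoot c s a T.
  move=> rc a0 T01; have c0 := lt_le_trans r0 rc.
  apply: le_trans (overshoot_ge0 _ c0 a0 T01).
  by case/andP: T01 => *; rewrite !mulr_ge0// ?subr_ge0// ltW.
have [[T xpos]|nxpos] := pselect (exists T, forall t, T <= t -> 0 < x t).
  exists 0, 0; split=> //; first exact: (positive_to0 r0 one xE xpos).
    by move=> w w0; exists T => t /xpos xt; lra.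
  by move=> c T' rc T01; split=> w w0; apply: os0 => //; auto.
have [[T xneg]|nxneg] := pselect (exists T, forall t, T <= t -> 0 < - x t).
  exists 0, 0; split=> //; last 2 first.
  - exact: (positive_to0 r0 mone NxE xneg).
  - by move=> c T' rc T01; split=> w w0; apply: os0 => //; auto.
  by move=> w w0; exists T => t /xneg xt; lra.
have oscN t1 : exists2 t, t1 <= t & x t <= 0.
  apply: contrapT => h; apply: nxpos; exists t1 => t t1t.
  by rewrite ltNge; apply/negP => xt; apply: h; exists t.
have oscP t1 : exists2 t, t1 <= t & - x t <= 0.
  apply: contrapT => h; apply: nxneg; exists t1 => t t1t.
  by rewrite ltNge; apply/negP => xt; apply: h; exists t.
have up (c T w : R) : r <= c -> 0 <= T <= 1 -> 0 < w ->
    ev_le (fun t => - x t) w -> ev_le x (overshoot c 1 (1 - expR (- w)) T).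
  move=> rc T01 w0 [t0 Ht0].
  apply: (ev_le_overshoot (t0 := t0) r0 one xE) => //; first exact: a1_gt0.
  move=> t /Ht0 xt; have : expR (- w) <= expR (x t) by rewrite ler_expR; lra.
  by rewrite !mul1r; lra.
have down (c T u : R) : r <= c -> 0 <= T <= 1 -> 0 < u ->
    ev_le x u -> ev_le (fun t => - x t) (overshoot c (-1) (expR u - 1) T).
  move=> rc T01 u0 [t0 Ht0].
  apply: (ev_le_overshoot (t0 := t0) r0 mone NxE) => //; first exact: a2_gt0.
  move=> t /Ht0 xt; have : expR (x t) <= expR u by rewrite ler_expR.
  by rewrite !mulN1r opprK; lra.
have T1 : 0 <= (1 : R) <= 1 by rewrite ler01 lexx.
(* The bootstrap: [exp x - 1 > -1] always holds, so [a = 1] bounds [x] above, and this in turn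
   bounds it below. *)
have [u xu] : exists u, ev_le x u.
  exists (overshoot r 1 1 1).
  apply: (ev_le_overshoot (t0 := 0) r0 one xE) => // t _.
  by rewrite !mul1r; have := expR_gt0 (x t); lra.
have [w xw] : exists w, ev_le (fun t => - x t) w.
  have u'0 : 0 < Num.max u 1 by rewrite lt_max ltr01 orbT.
  exists (overshoot r (-1) (expR (Num.max u 1) - 1) 1).
  apply: down => //; case: xu => T HT; exists T => t /HT xt.
  by rewrite le_max xt.
have oscP' t1 : exists2 t, t1 <= t & 0 <= x t.
  by have [t ? ?] := oscP t1; exists t => //; lra.
have oscN' t1 : exists2 t, t1 <= t & 0 <= - x t.
  by have [t ? ?] := oscN t1; exists t => //; lra.
have [U [U0 EU UE]] := limsup_exists xu oscP'.
have [W [W0 EW WE]] := limsup_exists xw oscN'.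
exists U, W; split=> // c T rc T01; split.
  move=> v Wv; apply: UE; apply: up => //; [exact: le_lt_trans Wv|exact: EW].
move=> v Uv; apply: WE; apply: down => //; [exact: le_lt_trans Uv|exact: EU].
Qed.

(** * Closed forms of the overshoots and Möbius bounds *)

Lemma overshoot_upstep (R : realType) (r w : R) : 0 < r -> 0 < w ->
  overshoot r 1 (1 - expR (- w)) 1 = upstep r w.
Proof.
move=> r0 w0; rewrite /overshoot /upstep /logF /expquot.
have : 0 < 1 - expR (- w) by rewrite subr_gt0 expR_lt1 oppr_lt0.
rewrite (_ : expR (- w) - 1 = - (1 - expR (- w))); last by ring.
set a := 1 - expR (- w) => a0.
rewrite !mul1r !mulr1 mulrN; set E := expR _.
by field; rewrite !gt_eqF.
Qed.

Lemma overshoot_downstep (R : realType) (r u : R) : 0 < r -> 0 < u ->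
  overshoot r (-1) (expR u - 1) 1 = downstep r u.
Proof.
move=> r0 u0; rewrite /overshoot /downstep /logF /expquot.
have : 0 < expR u - 1 by rewrite subr_gt0 expR_gt1.
set a := expR u - 1 => a0.
rewrite mulN1r opprK !mulr1; set E := expR _.
by field; rewrite !gt_eqF.
Qed.

(** The best [T] is where the two bounds cross, [3/2 a T = w]. If that lies beyond 1, [T = 1] is
    taken and [3/2 a < w] compensates. *)
Lemma overshoot_up_mobius (R : realType) (w : R) : 0 < w ->
  exists2 T : R, 0 <= T <= 1 &
    overshoot (3 / 2) 1 (1 - expR (- w)) T <= 3 * w / (3 + 2 * w).
Proof.
move=> w0; set a := 1 - expR (- w).
have a0 : 0 < a by rewrite subr_gt0 expR_lt1 oppr_lt0.
have a1 : a < 1 by rewrite /a; have := expR_gt0 (- w); lra.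
have [wa|aw] := leP w (3 / 2 * a).
  exists (w / (3 / 2 * a)).
    by rewrite divr_ge0 ?ler_pdivrMr ?mul1r//; lra.
  rewrite /overshoot.
  rewrite (_ : 3 / 2 * a * (w / (3 / 2 * a)) = w); last by field; lra.
  rewrite mul1r.
  have := expoly_up_mobius w0; have := pexpR_gt1 w0.
  rewrite {}/a expRN in a0 a1 wa *; set E := expR w in a0 a1 wa * => E1 h.
  have E0 : 0 < E by lra.
  rewrite -subr_ge0.
  have -> : 3 * w / (3 + 2 * w) - (3 / 2 * (1 - E^-1) *
      (1 - w / (3 / 2 * (1 - E^-1))) + 3 / 2 * 1 * (w / (3 / 2 * (1 - E^-1))) -
      (1 - E^-1) / (1 - E^-1)) =
    (E ^+ 2 * (2 * w - 3 / 2) + E * (6 - 2 * w - 2 * w ^+ 2)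
      - 3 * w - 9 / 2) / (E * (E - 1) * (3 + 2 * w)).
    by field; lra.
  by rewrite divr_ge0 ?ltW// !mulr_gt0//; lra.
exists 1; first by rewrite ler01 lexx.
rewrite /overshoot; set z := 3 / 2 * a.
have z0 : 0 < z by rewrite /z; lra.
have z1 : z < 3 / 2 by rewrite /z; lra.
have -> : z * (1 - 1) + 3 / 2 * 1 * 1 - (1 - expR (- (1 * (z * 1)))) / a =
    3 / 2 * ((expR (- z) - 1 + z) / z).
  by rewrite !mul1r !mulr1 /z; set e := expR _; field; lra.
have zw : 3 * z / (3 + 2 * z) <= 3 * w / (3 + 2 * w).
  rewrite ler_pdivrMr; last lra.
  by rewrite mulrAC ler_pdivlMr; [rewrite /z; nra|lra].
apply: le_trans zw.
apply: (@le_trans _ _ (3 / 2 * (3 * z / (6 + 2 * z)))).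
  rewrite ler_pM2l// ler_pdivrMr// mulrAC ler_pdivlMr; last lra.
  have := expR_pade12 z0; rewrite expRN.
  have : 0 < expR z by exact: expR_gt0.
  set E := expR z => E0 h.
  have : E^-1 * (6 + 2 * z) <= 6 - 4 * z + z ^+ 2.
    by rewrite ler_pdivrMl// ltW.
  lra.
(* This last comparison amounts to [z <= 3/2]. *)
rewrite mulrA ler_pdivrMr; last lra.
rewrite [leRHS]mulrAC ler_pdivlMr; last lra.
nra.
Qed.

(* [overshoot (3/2) (-1) (exp u - 1) T] for the optimal [T]. *)
Definition downstep32 (R : realType) (u : R) : R :=
  3 / 2 * (expR u - 1) - u - u / (expR u - 1) + 1.

(** Here the crossing [T = u / (3/2 a)] is always below 1, as [u <= exp u - 1]. *)
Lemma overshoot_downstep32 (R : realType) (u : R) : 0 < u ->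
  exists2 T : R, 0 <= T <= 1 &
    overshoot (3 / 2) (-1) (expR u - 1) T = downstep32 u.
Proof.
move=> u0; have := expR_gt1Dx (lt0r_neq0 u0).
rewrite /downstep32; set a := expR u - 1 => ua.
have a0 : 0 < a by rewrite /a; lra.
exists (u / (3 / 2 * a)).
  have ua' : u <= a by rewrite /a; lra.
  by rewrite divr_ge0 ?ler_pdivrMr ?mul1r//; lra.
rewrite /overshoot.
rewrite (_ : 3 / 2 * a * (u / (3 / 2 * a)) = u); last by field; lra.
rewrite mulN1r opprK (_ : expR u = a + 1); last by rewrite /a; ring.
by field; lra.
Qed.

(** The right side is the inverse of the Möbius map [3 w / (3 + 2 w)] bounding [U], which is what
    makes the two bounds incompatible. *)
Lemma downstep32_lt (R : realType) (u : R) : 0 < u < 3 / 2 ->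
  downstep32 u < 3 * u / (3 - 2 * u).
Proof.
move=> /andP[u0 u1]; rewrite /downstep32.
have := expoly_down_mobius u0; have := pexpR_gt1 u0; set E := expR u => E1 h.
rewrite -subr_gt0.
have -> : 3 * u / (3 - 2 * u) - (3 / 2 * (E - 1) - u - u / (E - 1) + 1) =
  (E ^+ 2 * (3 * u - 9 / 2) + E * (6 + 2 * u - 2 * u ^+ 2) - 2 * u - 3 / 2) /
  ((E - 1) * (3 - 2 * u)).
  by field; lra.
by rewrite divr_gt0// mulr_gt0//; lra.
Qed.

Lemma downstep32_continuous (R : realType) (u : R) : 0 < u ->
  {for u, continuous (@downstep32 R)}.
Proof.
move=> u0; rewrite /downstep32; have E0 : expR u - 1 != 0.
  by rewrite gt_eqF// subr_gt0 expR_gt1.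
have cE : {for u, continuous (fun u : R => expR u - 1)}.
  by apply: cvgB; [exact: continuous_expR|exact: cvg_cst].
apply: cvgD; last exact: cvg_cst.
apply: cvgB; last by apply: cvgM; [exact: cvg_id|exact: cvgV].
apply: cvgB; last exact: cvg_id.
by apply: cvgM; [exact: cvg_cst|exact: cE].
Qed.

(** * From Wright's equation to its logarithmic form *)

(** With [K] at least [r y] on [-1, t], the function [(1 + y) ^ 2 exp (2 K v)] is nondecreasing on
    [0, t], so [1 + y] cannot vanish; the square makes the sign of [1 + y] irrelevant. *)
Lemma wright_gtN1 (R : realType) (r : R) (y : R -> R) : 0 < r ->
  wright_solution r y -> -1 < y 0 -> forall t, 0 <= t -> -1 < y t.
Proof.
move=> r0 [yc yE] y0.
have yI (a b : R) : -1 <= a -> {within `[a, b], continuous y}.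
  move=> a1; apply: continuous_subspaceW yc => t /=.
  by rewrite !in_itv/= andbT => /andP[/(le_trans a1)].
have neq (t : R) : 0 <= t -> 1 + y t != 0.
  rewrite le_eqVlt => /predU1P[<-|t0]; first by rewrite gt_eqF//; lra.
  have t1 : -1 <= t by lra.
  have [m mI mmax] := EVT_max t1 (yI _ _ (lexx _)).
  pose K := r * y m.
  pose g v := (1 + y v) ^+ 2 * expR (2 * K * v).
  pose dg v := 2 * (K - r * y (v - 1)) * g v.
  (* The equation starts strictly after time 0, where only continuity is available. *)
  have gE (v : R) : v \in `]0, t[ -> is_derive v 1 g (dg v).
    rewrite in_itv/= => /andP[v0 vt]; have dy := yE v v0.
    have de : is_derive v 1 (fun v => expR (2 * K * v))
        (expR (2 * K * v) * (2 * K)).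
      apply: (@is_derive1_comp _ expR (fun v => 2 * K * v)).
      by apply: is_derive_eq; rewrite /GRing.scale/=; ring.
    apply: is_derive_eq.
    by rewrite /dg /g /GRing.scale/=; ring.
  have gc : {within `[0, t], continuous g}.
    have y2c : {within `[0, t], continuous ((fun z => (1 + z) ^+ 2) \o y)}.
      apply: within_continuous_comp; last by apply: yI; lra.
      move=> z _; apply: is_derive_continuous.
    have ec : {within `[0, t], continuous (fun v => expR (2 * K * v))}.
      apply: continuous_subspaceT => v.
      apply: (@continuous_comp _ _ _ (fun v : R => 2 * K * v) expR).
        exact: mulrl_continuous.
      exact: continuous_expR.
    move=> v; exact: (@continuousM R (subspace `[0, t]) _ _ v (y2c v) (ec v)).
  have [c cI gtE] := MVT t0 gE gc.
  have gle : g 0 <= g t.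
    rewrite -subr_ge0 gtE mulr_ge0//; last lra.
    move: cI; rewrite in_itv/= => /andP[c0 ct].
    apply: mulr_ge0; last by apply: mulr_ge0; [exact: sqr_ge0|exact: expR_ge0].
    apply: mulr_ge0 => //; rewrite subr_ge0 /K ler_pM2l//.
    by apply: mmax; rewrite in_itv/=; lra.
  have g0 : 0 < g 0.
    by rewrite /g mulr0 expR0 mulr1 exprn_gt0//; lra.
  apply/eqP => yt; move: (lt_le_trans g0 gle).
  by rewrite /g yt expr0n/= mul0r ltxx.
move=> t t0; rewrite ltNge; apply/negP => yt.
have m10 : (-1 : R) <= 0 by lra.
have [|c cI yc1] := IVT t0 (yI 0 t m10) (v := -1).
  by rewrite ge_min le_max yt (ltW y0) orbT.
move: cI; rewrite in_itv/= => /andP[c0 _].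
by have := neq _ c0; rewrite yc1 subrr eqxx.
Qed.

(** Divide by [1 + y]. Expressing [y (t - 1)] through its logarithm uses [y > -1] at a time
    [t - 1 >= 0], hence [t > 1] in [signed_wright]. *)
Lemma wright_log (R : realType) (r : R) (y : R -> R) : 0 < r ->
  wright_solution r y -> -1 < y 0 ->
  signed_wright r 1 (fun t => ln (1 + y t)) /\
  signed_wright r (-1) (fun t => - ln (1 + y t)).
Proof.
move=> r0 yw y0; have [_ yE] := yw; have ygt := wright_gtN1 r0 yw y0.
have main (t : R) : 1 < t ->
    is_derive t 1 (fun t => ln (1 + y t)) (- r * y (t - 1)).
  move=> t1; have dy : is_derive t 1 y (- r * y (t - 1) * (1 + y t)).
    by apply: yE; lra.
  have yt : 0 < 1 + y t by have := ygt t; rewrite -ltrBlDl sub0r; apply; lra.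
  have dl : is_derive (1 + y t) 1 (@ln R) (1 + y t)^-1 by exact: is_derive1_ln.
  have dy1 : is_derive t 1 (fun t => 1 + y t) (- r * y (t - 1) * (1 + y t)).
    by have := is_deriveD (is_derive_cst (1 : R) t 1) dy; rewrite add0r.
  have := @is_derive1_comp _ (@ln R) (fun t => 1 + y t) t _ _ dl dy1.
  by rewrite mulrC mulfK// gt_eqF.
have yx (t : R) : 1 < t -> expR (ln (1 + y (t - 1))) = 1 + y (t - 1).
  by move=> t1; rewrite lnK// posrE; have := ygt (t - 1); lra.
split=> t t1.
  by rewrite !mul1r yx// addrC addKr; exact: main.
have dx := main t t1.
apply: is_derive_eq; rewrite !mulN1r opprK yx//; ring.
Qed.

Lemma limsup_le (R : realType) (y : R -> R) (b : R) :
  (forall e, 0 < e -> ev_le y (b + e)) -> (limsup_pinfty y <= b%:E)%E.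
Proof.
move=> H; apply/lee_addgt0Pr => e e0; have [T HT] := H _ e0.
rewrite /limsup_pinfty limf_esupE; apply: ereal_inf_le.
exists (ereal_sup ((fun t => (y t)%:E) @` [set t | T < t])).
  exists [set t | T < t] => //; exists T; split=> //; exact: num_real.
by apply: ge_ereal_sup => _ [t /= Tt <-]; rewrite -EFinD lee_fin HT// ltW.
Qed.

Lemma liminf_ge (R : realType) (y : R -> R) (b : R) :
  (forall e, 0 < e -> ev_le (fun t => - y t) (- b + e)) ->
  (b%:E <= liminf_pinfty y)%E.
Proof.
move=> H; rewrite /liminf_pinfty.
rewrite /limf_einf leeNr -EFinN; exact: (limsup_le H).
Qed.

Lemma liminf_le_limsup (R : realType) (y : R -> R) :
  (liminf_pinfty y <= limsup_pinfty y)%E.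
Proof.
rewrite /liminf_pinfty /limsup_pinfty limf_esupE limf_einfE.
apply: ge_ereal_sup => _ [A FA <-]; apply: le_ereal_inf_tmp => _ [B FB <-].
have [t [At Bt]] := filter_ex (filterI FA FB).
apply: (@le_trans _ _ (y t)%:E).
  by apply: ereal_inf_lbound; exists t.
by apply: ereal_sup_ubound; exists t.
Qed.

(** * Solving the inequalities between [U] and [W] *)

Lemma wright_limits_bounds (R : realType) (r U W u0 : R) : 3 / 2 <= r ->
  0 < u0 -> upstep r (downstep r u0) = u0 -> 0 <= U -> 0 <= W ->
  (forall w, W < w -> U <= upstep r w) ->
  (forall u, U < u -> W <= downstep r u) ->
  U <= u0 /\ W <= downstep r u0.
Proof.
move=> r32 u0_gt0 fixu0 U0 W0 UE WE; have r0 : 0 < r by lra.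
have Uu0 : U <= u0.
  rewrite leNgt; apply/negP => u0U.
  have U_gt0 : 0 < U by exact: lt_trans u0U.
  pose rho u := upstep r (downstep r u) / u.
  have rhoU : rho U < 1.
    have := step_ratio_decr r0 r32 u0_gt0 u0U.
    by rewrite fixu0 divff// gt_eqF.
  suff : U <= U * rho U by rewrite leNgt gtr_pMr// rhoU.
  apply: (@le_of_le_right _ (fun u => u * rho U)) => [|u Uu].
    exact: mulrr_continuous.
  have u_gt0 : 0 < u by exact: lt_trans Uu.
  apply: (@le_trans _ _ (u * rho u)); last first.
    by rewrite ler_pM2l// ltW//; exact: step_ratio_decr.
  rewrite /rho mulrC divfK ?gt_eqF//; apply: UE.
  (* The midpoint makes [W < downstep r u] strict, as [UE] demands. *)
  have Um : U < (U + u) / 2 by lra.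
  by apply: (le_lt_trans (WE _ Um)); apply: downstep_lt => //; lra.
split=> //; apply: le_of_le_right => [|u u0u].
  exact: (is_derive_continuous (is_derive_downstep r0 u0_gt0)).
by apply: WE; exact: le_lt_trans u0u.
Qed.

Lemma wright_limits_eq0 (R : realType) (U W : R) : 0 <= U -> 0 <= W ->
  (forall w, W < w -> U <= 3 * w / (3 + 2 * w)) ->
  (forall u, U < u -> W <= downstep32 u) -> U = 0 /\ W = 0.
Proof.
move=> U0 W0 UE WE.
have UW : 3 * U <= W * (3 - 2 * U).
  apply: (@le_of_le_right _ (fun w => w * (3 - 2 * U))) => [|w Ww].
    exact: mulrr_continuous.
  by have := UE _ Ww; rewrite ler_pdivlMr; lra.
have U32 : U < 3 / 2.
  rewrite ltNge; apply/negP => U32.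
  by have := mulr_ge0_le0 W0 (_ : 3 - 2 * U <= 0); lra.
have [U_eq0|U_neq0] := eqVneq U 0.
  split=> //; apply/eqP; rewrite eq_le W0 andbT -oppr_ge0.
  (* At 0, [downstep32] has the value 1 by the convention [0 / 0 = 0], so the limit is taken in the
     Möbius bound instead. *)
  have : 3 * W <= (3 + 2 * W) * U.
    apply: (@le_of_le_right _ ( *%R (3 + 2 * W))) => [|u Uu].
      exact: mulrl_continuous.
    have [u32|u32] := ltP u (3 / 2); last first.
      by have := mulr_ge0_le0 W0 (_ : 3 - 2 * u <= 0); lra.
    have u0 : 0 < u < 3 / 2 by rewrite u32 andbT; lra.
    have := le_lt_trans (WE _ Uu) (downstep32_lt u0).
    by rewrite ltr_pdivlMr; lra.
  by rewrite U_eq0; lra.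
have U_gt0 : 0 < U by rewrite lt_neqAle eq_sym U_neq0.
have Wq : W <= downstep32 U.
  by apply: le_of_le_right => //; exact: downstep32_continuous.
have UI : 0 < U < 3 / 2 by rewrite U_gt0.
have := le_lt_trans Wq (downstep32_lt UI).
by rewrite ltr_pdivlMr; lra.
Qed.

Theorem proposition3 (R : realType) (r : R) (hr : 1 < r) (y : R -> R)
    (hy : wright_solution r y) (hy0 : -1 < y 0) :
  (r <= 3 / 2 -> y t @[t --> +oo] --> (0 : R)) /\
  (3 / 2 < r ->
    exists alpha1 beta1 : R,
      [/\ alpha1 < beta1,
          unique (two_cycle (F r)) [set alpha1; beta1],
          (alpha1%:E <= liminf_pinfty y)%E,
          (liminf_pinfty y <= limsup_pinfty y)%E
        & (limsup_pinfty y <= beta1%:E)%E]).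
Proof.
have r0 : 0 < r by lra.
have [xE NxE] := wright_log r0 hy hy0.
have [U [W [U0 W0 EU EW UW]]] := wright_limits r0 xE NxE.
have ygt := wright_gtN1 r0 hy hy0.
have yx (t : R) : 0 <= t -> y t = expR (ln (1 + y t)) - 1.
  by move=> t0; rewrite lnK ?posrE; have := ygt t t0; lra.
have yU (u : R) : U < u -> ev_le y (expR u - 1).
  move=> /EU[T HT]; exists (Num.max T 0) => t; rewrite ge_max => /andP[Tt t0].
  by rewrite (yx t t0) lerD2r ler_expR; exact: HT.
have yW (w : R) : W < w -> ev_le (fun t => - y t) (1 - expR (- w)).
  move=> /EW[T HT]; exists (Num.max T 0) => t; rewrite ge_max => /andP[Tt t0].
  rewrite (yx t t0) opprB lerD2l lerN2 ler_expR lerNl; exact: HT.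
split=> r32.
  have [U_eq0 W_eq0] : U = 0 /\ W = 0.
    apply: wright_limits_eq0 => // [w Ww|u Uu].
      have [|T T01] := @overshoot_up_mobius _ w; first exact: le_lt_trans Ww.
      by apply: le_trans; apply: (UW _ _ r32 T01).1.
    have [|T T01 <-] := @overshoot_downstep32 _ u; first exact: le_lt_trans Uu.
    exact: (UW _ _ r32 T01).2.
  apply/cvgrPdist_le => e e0.
  have [|T1 H1] := yU (ln (1 + e)); first by rewrite U_eq0 ln_gt0// ltrDl.
  have [|T2 H2] := yW e; first by rewrite W_eq0.
  exists (Num.max T1 T2); split; first exact: num_real.
  move=> t; rewrite gt_max => /andP[/ltW/H1 h1 /ltW/H2 h2].
  rewrite sub0r normrN ler_norml; apply/andP; split.
    by have := expR_ge1Dx (- e); lra.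
  by move: h1; rewrite lnK ?posrE; lra.
have r32' : 3 / 2 <= r by exact: ltW.
have [u0 u0_gt0 fixu0] := step_fixpoint_exists r0 r32'.
have w0_gt0 : 0 < downstep r u0 by exact: downstep_gt0.
have T01 : 0 <= (1 : R) <= 1 by rewrite ler01 lexx.
have [Uu0 Wu0] : U <= u0 /\ W <= downstep r u0.
  apply: wright_limits_bounds => // [w Ww|u Uu].
    rewrite -overshoot_upstep//; last exact: le_lt_trans Ww.
    exact: (UW _ _ (lexx r) T01).1.
  rewrite -overshoot_downstep//; last exact: le_lt_trans Uu.
  exact: (UW _ _ (lexx r) T01).2.
exists (expR (- downstep r u0) - 1), (expR u0 - 1); split.
- by rewrite ltrD2r ltr_expR; lra.
- exact: two_cycle_unique.
- apply: liminf_ge => e e0.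
  have E0 := expR_gt0 (- downstep r u0).
  pose w := downstep r u0 + e.
  have [T HT] : ev_le (fun t => - y t) (1 - expR (- w)).
    by apply: yW; rewrite /w; lra.
  exists T => t /HT /le_trans; apply.
  (* Lowering the logarithm by [e] lowers [exp] by at most [e], since the exponential here is below
     1. *)
  have : expR (- downstep r u0) * (1 - e) <= expR (- w).
    rewrite /w opprD expRD ler_pM2l//; have := expR_ge1Dx (- e); lra.
  have : expR (- downstep r u0) * e <= e.
    by rewrite ger_pMl// ltW// expR_lt1; lra.
  lra.
- exact: liminf_le_limsup.
- apply: limsup_le => e e0.
  have E0 := expR_gt0 u0.
  have [T HT] : ev_le y (expR (ln (expR u0 + e)) - 1).
    apply: yU; apply: (le_lt_trans Uu0).
    by rewrite -ltr_expR lnK ?posrE; lra.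
  exists T => t /HT; rewrite lnK ?posrE; lra.
Qed.
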